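(* Let $U\in\mathrm{SpSt}(2n,2k)$ and $\Delta\in T_U\mathrm{SpSt}(2n,2k)$. Define $A:=U^+\Delta$ and $H:=\Delta-UA$. Then, for all $t\in\mathbb{R}$ for which the Cayley transform defining $\mathcal{R}^{\mathrm{SpSt}}_U(t\Delta)$ exists, $$\mathcal{R}^{\mathrm{SpSt}}_U(t\Delta)=-U+(tH+2U)\left(\frac{t^2}{4}H^+H-\frac t2A+I_{2k}\right)^{-1}.$$
   Context: Let $k\le n$ be positive integers, $J_{2m}=\begin{bmatrix}0&I_m\\-I_m&0\end{bmatrix}$, and for a real $2a\times 2b$ matrix $A$ put $A^+:=J_{2b}^TA^TJ_{2a}$. $\mathfrak{sp}(2k,\mathbb{R})=\{\Omega\in\mathbb{R}^{2k\times2k}:\Omega^+=-\Omega\}$. $\mathrm{SpSt}(2n,2k)=\{U\in\mathbb{R}^{2n\times2k}:U^+U=I_{2k}\}$ with $T_U\mathrm{SpSt}(2n,2k)=\{\Delta\in\mathbb{R}^{2n\times2k}: U^+\Delta\in\mathfrak{sp}(2k,\mathbb{R})\}$. The Cayley transform is $\mathrm{cay}(X)=(I+X)(I-X)^{-1}$ (defined when $I-X$ is invertible). The Cayley retraction on $\mathrm{SpSt}(2n,2k)$ is $\mathcal{R}^{\mathrm{SpSt}}_U(\Delta)=\mathrm{cay}\left(\frac12\tilde\Omega(U,\Delta)\right)U$, where $\tilde\Omega(U,\Delta)=\left(I_{2n}-\frac12UU^+\right)\Delta U^+-U\Delta^+\left(I_{2n}-\frac12UU^+\right)$. *)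

(* Defs.v *)
From HB Require Import structures.
From mathcomp Require Import all_boot all_order all_algebra.
From mathcomp Require Import reals.

Set Implicit Arguments.
Unset Strict Implicit.
Unset Printing Implicit Defensive.

Import Order.TTheory GRing.Theory Num.Theory.
Local Open Scope ring_scope.

(* Matrices of even size 2a x 2b have type 'M[R]_(a + a, b + b), so that the   *)
(* block operations apply without casts.                                       *)

Definition Jmx (R : realType) (m : nat) : 'M[R]_(m + m) :=
  block_mx 0 1%:M (- 1%:M) 0.

(* The symplectic inverse A^+ = J_{2b}^T A^T J_{2a}; no nondegeneracy of A is  *)
(* assumed. It is unrelated to the ring power x ^+ n.                          *)
Definition symp_inv (R : realType) (a b : nat)
    (A : 'M[R]_(a + a, b + b)) : 'M[R]_(b + b, a + a) :=
  (Jmx R b)^T *m A^T *m Jmx R a.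

Definition in_sp (R : realType) (k : nat) (Omega : 'M[R]_(k + k)) : Prop :=
  symp_inv Omega = - Omega.

Definition in_SpSt (R : realType) (n k : nat)
    (U : 'M[R]_(n + n, k + k)) : Prop :=
  symp_inv U *m U = 1%:M.

Definition in_tangent_SpSt (R : realType) (n k : nat)
    (U Delta : 'M[R]_(n + n, k + k)) : Prop :=
  in_sp (symp_inv U *m Delta).

(* cay is total because invmx is; its value is meaningful only under           *)
(* cay_defined.                                                                *)
Definition cay_defined (R : realType) (m : nat) (X : 'M[R]_m) : Prop :=
  1%:M - X \in unitmx.

Definition cay (R : realType) (m : nat) (X : 'M[R]_m) : 'M[R]_m :=
  (1%:M + X) *m invmx (1%:M - X).

Definition tOmega (R : realType) (n k : nat)
    (U Delta : 'M[R]_(n + n, k + k)) : 'M[R]_(n + n) :=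
  (1%:M - 2^-1 *: (U *m symp_inv U)) *m Delta *m symp_inv U
  - U *m symp_inv Delta *m (1%:M - 2^-1 *: (U *m symp_inv U)).

Definition cay_retraction_defined (R : realType) (n k : nat)
    (U Delta : 'M[R]_(n + n, k + k)) : Prop :=
  cay_defined (2^-1 *: tOmega U Delta).

Definition cay_retraction (R : realType) (n k : nat)
    (U Delta : 'M[R]_(n + n, k + k)) : 'M[R]_(n + n, k + k) :=
  cay (2^-1 *: tOmega U Delta) *m U.

(* Main.v *)
Require Import Defs.
From HB Require Import structures.
From mathcomp Require Import all_boot all_order all_algebra.
From mathcomp Require Import reals.
From mathcomp Require Import ring.

Set Implicit Arguments.
Unset Strict Implicit.
Unset Printing Implicit Defensive.

Import Order.TTheory GRing.Theory Num.Theory.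
Local Open Scope ring_scope.

(** Put X := (t/2) Omega~(U, Delta), so that the retraction is cay(X) U.  Since
    cay(X) = -I + 2 (I - X)^-1, only (I - X)^-1 U has to be computed, and for
    this no 2n x 2n inverse is needed: the span of the columns of U and H is
    stable under X.  Indeed U^+ H = 0 and H^+ U = 0, so the decomposition
    Delta = U A + H and the tangency A^+ = -A turn Omega~ into
    U A U^+ + H U^+ - U H^+ ([tOmega_decomp]), whence
      X U = (t/2) (U A + H)   and   X H = - (t/2) U H^+ H.
    In the combination W := U + (t/2) H the two terms along H cancel:
      (I - X) W = U M,   M := (t^2/4) H^+ H - (t/2) A + I
    ([cayley_intertwining]).  Moreover U^+ W = I, so U^+ (I - X)^-1 U is a left
    inverse of M; thus M is invertible and (I - X)^-1 U = W M^-1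
    ([cay_mul_intertwined]), which is the claimed formula. *)

Lemma mulJJ (R : realType) m : Jmx R m *m Jmx R m = - 1%:M.
Proof.
rewrite /Jmx mulmx_block !mul0mx !mulmx0 !mulmx1 !mul1mx !addr0 !add0r.
by rewrite [in RHS]scalar_mx_block opp_block_mx oppr0.
Qed.

Lemma trJ (R : realType) m : (Jmx R m)^T = - Jmx R m.
Proof.
rewrite /Jmx tr_block_mx opp_block_mx !trmx0 linearN /= trmx1.
by rewrite opprK oppr0.
Qed.

Lemma symp_invK (R : realType) a b (A : 'M[R]_(a + a, b + b)) :
  symp_inv (symp_inv A) = A.
Proof.
rewrite /symp_inv !trmx_mul !trmxK !trJ !mulmxA mulNmx mulmxN opprK mulJJ.
by rewrite -mulmxA mulJJ mulmxN mulmx1 mulNmx mul1mx opprK.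
Qed.

Lemma symp_invM (R : realType) a b c
    (A : 'M[R]_(a + a, b + b)) (B : 'M[R]_(b + b, c + c)) :
  symp_inv (A *m B) = symp_inv B *m symp_inv A.
Proof.
rewrite /symp_inv trmx_mul !trJ !mulNmx mulmxN opprK !mulmxA.
by rewrite -(mulmxA _ (Jmx R b) (Jmx R b)) mulJJ mulmxN mulmx1 !mulNmx.
Qed.

Lemma symp_invD (R : realType) a b (A B : 'M[R]_(a + a, b + b)) :
  symp_inv (A + B) = symp_inv A + symp_inv B.
Proof. by rewrite /symp_inv linearD /= mulmxDr mulmxDl. Qed.

Lemma symp_invZ (R : realType) a b (c : R) (A : 'M[R]_(a + a, b + b)) :
  symp_inv (c *: A) = c *: symp_inv A.
Proof. by rewrite /symp_inv linearZ /= -scalemxAr -scalemxAl. Qed.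

Lemma symp_inv0 (R : realType) a b :
  symp_inv (0 : 'M[R]_(a + a, b + b)) = 0.
Proof. by rewrite /symp_inv trmx0 mulmx0 mul0mx. Qed.

Lemma symp_orthC (R : realType) a b c
    (A : 'M[R]_(a + a, b + b)) (B : 'M[R]_(a + a, c + c)) :
  symp_inv A *m B = 0 -> symp_inv B *m A = 0.
Proof.
by move=> AB0; rewrite -[A in LHS]symp_invK -symp_invM AB0 symp_inv0.
Qed.

(** An identity (I - X) W = U M lets a small matrix M take the place of I - X
    as soon as W has a left inverse V: then V (I - X)^-1 U M = V W = I. *)
Lemma cay_mul_intertwined (R : realType) m p (X : 'M[R]_m)
    (U W : 'M[R]_(m, p)) (V : 'M[R]_(p, m)) (M : 'M[R]_p) :
  cay_defined X -> V *m W = 1%:M -> (1%:M - X) *m W = U *m M ->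
  M \in unitmx /\ cay X *m U = - U + 2 *: (W *m invmx M).
Proof.
rewrite /cay_defined => unitX VW1 XW.
have WE : W = invmx (1%:M - X) *m U *m M by rewrite -mulmxA -XW mulKmx.
have unitM : M \in unitmx.
  have := VW1; rewrite [W in V *m W]WE mulmxA => /mulmx1_unit.
  by case.
split=> //.
have WM : W *m invmx M = invmx (1%:M - X) *m U by rewrite {1}WE mulmxK.
have -> : cay X = 2 *: invmx (1%:M - X) - 1%:M.
  have XE : 1%:M + X = 2%:M - (1%:M - X).
    by rewrite opprB addrCA mulr2n raddfD /= addrK addrC.
  by rewrite /cay [in LHS]XE mulmxBl mulmxV // mul_scalar_mx.
by rewrite WM mulmxBl mul1mx -scalemxAl addrC.
Qed.

(** The factor I - U U^+ / 2 halves the component along U and fixes the one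
    along H; the two halves then add up because A^+ = -A. *)
Lemma tOmega_decomp (R : realType) n k (U H : 'M[R]_(n + n, k + k))
    (A : 'M[R]_(k + k)) :
  in_SpSt U -> in_sp A -> symp_inv U *m H = 0 ->
  tOmega U (U *m A + H)
    = U *m A *m symp_inv U + H *m symp_inv U - U *m symp_inv H.
Proof.
rewrite /in_SpSt /in_sp /tOmega => UU A_sp UH.
have HU := symp_orthC UH.
rewrite symp_invD symp_invM A_sp mulNmx.
(* Only these relations matter from here on; abstracting the inverses keeps
   associativity rewriting from reaching inside their definition. *)
move: (symp_inv U) (symp_inv H) UU UH HU => Up Hp UU UH HU.
have half (p q : nat) (B : 'M[R]_(p, q)) : B - 2^-1 *: B = 2^-1 *: B.
  by rewrite -{1}[B]scale1r -scalerBl; congr (_ *: _); field.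
have projL : (1%:M - 2^-1 *: (U *m Up)) *m (U *m A + H)
    = 2^-1 *: (U *m A) + H.
  rewrite mulmxBl mul1mx -scalemxAl mulmxDr -!mulmxA UH mulmx0 addr0.
  by rewrite (mulmxA Up) UU mul1mx addrAC half.
have projR : (- (A *m Up) + Hp) *m (1%:M - 2^-1 *: (U *m Up))
    = - (2^-1 *: (A *m Up)) + Hp.
  rewrite mulmxBr mulmx1 -scalemxAr mulmxDl mulNmx !mulmxA HU mul0mx addr0.
  by rewrite -(mulmxA A) UU mulmx1 addrAC half scalerN.
rewrite projL -(mulmxA U) projR mulmxDl mulmxDr mulmxN opprD opprK.
rewrite -scalemxAl -scalemxAr mulmxA addrACA -[RHS]addrA.
by rewrite -scalerDl (_ : 2^-1 + 2^-1 = 1 :> R) ?scale1r //; field.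
Qed.

Lemma tOmegaZ (R : realType) n k (t : R) (U Delta : 'M[R]_(n + n, k + k)) :
  tOmega U (t *: Delta) = t *: tOmega U Delta.
Proof.
by rewrite /tOmega symp_invZ -!scalemxAr -!scalemxAl scalerBr.
Qed.

(** The coefficient s of H in U + s H is the one for which the terms along H
    cancel, leaving a vector in the range of U. *)
Lemma cayley_intertwining (R : realType) n k (s : R)
    (U H : 'M[R]_(n + n, k + k)) (A : 'M[R]_(k + k)) :
  in_SpSt U -> in_sp A -> symp_inv U *m H = 0 ->
  (1%:M - s *: tOmega U (U *m A + H)) *m (U + s *: H)
    = U *m (s ^+ 2 *: (symp_inv H *m H) - s *: A + 1%:M).
Proof.
move=> U_SpSt A_sp UH; rewrite (tOmega_decomp U_SpSt A_sp UH).
have UU : symp_inv U *m U = 1%:M by [].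
have HU := symp_orthC UH.
move: (symp_inv U) (symp_inv H) UU UH HU => Up Hp UU UH HU.
set X := (_ + _ - _).
have XU : X *m U = U *m A + H.
  by rewrite mulmxBl mulmxDl -!mulmxA UU HU !mulmx1 mulmx0 subr0.
have XH : X *m H = - (U *m (Hp *m H)).
  by rewrite mulmxBl mulmxDl -!mulmxA UH !mulmx0 addr0 sub0r.
rewrite mulmxBl mul1mx -scalemxAl [X *m _]mulmxDr -scalemxAr XU XH.
rewrite !mulmxDr mulmx1 mulmxN -!scalemxAr !scalerDr !scalerN scalerA -expr2.
rewrite !opprD opprK addrA addrACA subrr addr0 -addrA [RHS]addrC.
by rewrite [in LHS](addrC (- _)).
Qed.

Theorem proposition5p2 (R : realType) (n k : nat) (k_gt0 : (0 < k)%N)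
    (le_kn : (k <= n)%N) (U Delta : 'M[R]_(n + n, k + k))
    (U_SpSt : in_SpSt U) (Delta_tangent : in_tangent_SpSt U Delta) :
  let A : 'M[R]_(k + k) := symp_inv U *m Delta in
  let H : 'M[R]_(n + n, k + k) := Delta - U *m A in
  forall t : R, cay_retraction_defined U (t *: Delta) ->
    let M : 'M[R]_(k + k) :=
      (t ^+ 2 / 4) *: (symp_inv H *m H) - (t / 2) *: A + 1%:M in
    M \in unitmx /\
    cay_retraction U (t *: Delta) = - U + (t *: H + 2 *: U) *m invmx M.
Proof.
move=> A H t cay_def M.
have UU : symp_inv U *m U = 1%:M by [].
have UH : symp_inv U *m H = 0.
  by rewrite /H mulmxBr mulmxA UU mul1mx subrr.
have DeltaE : Delta = U *m A + H by rewrite /H addrC subrK.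
have UW : symp_inv U *m (U + (t / 2) *: H) = 1%:M.
  by rewrite mulmxDr UU -scalemxAr UH scaler0 addr0.
have OmegaE : 2^-1 *: tOmega U (t *: Delta) = (t / 2) *: tOmega U Delta.
  by rewrite tOmegaZ scalerA mulrC.
have XW : (1%:M - 2^-1 *: tOmega U (t *: Delta)) *m (U + (t / 2) *: H)
    = U *m M.
  rewrite OmegaE [in LHS]DeltaE cayley_intertwining // /M.
  by rewrite (_ : (t / 2) ^+ 2 = t ^+ 2 / 4) //; field.
have [unitM cayU] := cay_mul_intertwined cay_def UW XW.
split=> //; rewrite /cay_retraction cayU scalemxAl scalerDr scalerA.
by rewrite (_ : 2 * (t / 2) = t) 1?[t *: H + _]addrC //; field.
Qed.
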